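(* Let $k=\mathbb{F}_2$ and let $U(\mathcal{S}h)$ be the suboperad of $U(\mathcal{S})$ generated by the surjection-like elements. Then for every simplicial set $X$ the following diagram of operad morphisms commutes: for every $x\in U(\mathcal{S}h)(m)$, $$U(\varphi)_X(x)=\phi_X\big(\Psi(q(x))\big)\in\mathrm{End}(\mathrm{C}_\bullet(X))(m),$$ where $U(\varphi)_X:U(\mathcal{S})\to\mathrm{End}(\mathrm{C}_\bullet(X))$, $q:U(\mathcal{S}h)\to U(\mathcal{MS})$ (the restriction of the quotient map $U(\mathcal{S})\twoheadrightarrow U(\mathcal{MS})$), $\Psi:U(\mathcal{MS})\xrightarrow{\cong}Sur$ and $\phi_X:Sur\to\mathrm{End}(\mathrm{C}_\bullet(X))$ are as in the context.
   Context: Chain complexes over $\mathbb{F}_2$. A prop $\mathcal{P}$ is a strict symmetric monoidal category enriched in chain complexes generated by one object, $\mathcal{P}(n,m)$ the morphisms from $n$ to $m$ copies; $\circ$ vertical, $\otimes$ horizontal composition, $\mathrm{id}\in\mathcal{P}(1,1)$; $U(\mathcal{P})(m)=\mathcal{P}(1,m)$ with $x\circ_r y=(\mathrm{id}^{\otimes r-1}\otimes y\otimes\mathrm{id}^{\otimes m'-r})\circ x$. $\mathrm{End}(C)(m)=\mathrm{Hom}(C,C^{\otimes m})$. The prop $\mathcal{S}$: free prop on the free $\Sigma$-bimodule generated by $\varepsilon\in\mathcal{S}(1,0)_0$, $\Delta\in\mathcal{S}(1,2)_0$, $\mu\in\mathcal{S}(2,1)_1$, with derivation differential $\partial\varepsilon=0$,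 $\partial\Delta=0$, $\partial\mu=(\varepsilon\otimes\mathrm{id})-(\mathrm{id}\otimes\varepsilon)$, modulo the dg prop ideal generated by $\varepsilon\circ\mu$, $(\varepsilon\otimes\mathrm{id})\circ\Delta-\mathrm{id}$, $(\mathrm{id}\otimes\varepsilon)\circ\Delta-\mathrm{id}$. $\mathcal{MS}$ is its quotient by the dg prop ideal generated additionally by $\mu-\mu\cdot(12)$, $\mu\circ(\mu\otimes\mathrm{id})-\mu\circ(\mathrm{id}\otimes\mu)$, $(\Delta\otimes\mathrm{id})\circ\Delta-(\mathrm{id}\otimes\Delta)\circ\Delta$, $\Delta\circ\mu-(\mathrm{id}\otimes\mu)\circ(\Delta\otimes\mathrm{id})-(\mu\otimes\mathrm{id})\circ(\mathrm{id}\otimes\Delta)$, $\mu\circ\Delta$. Iterated operations: $\Delta^{(1)}=\mathrm{id}$, $\Delta^{(n+1)}=(\Delta^{(n)}\otimes\mathrm{id})\circ\Delta$; $\mu^{(1)}=\mathrm{id}$, $\mu^{(k+1)}=\mu\circ(\mu^{(k)}\otimes\mathrm{id})$. For a surjection $s:\{1,\dots,n\}\to\{1,\dots,m\}$ with $k_r=|s^{-1}(r)|$, the surjection-like element with associated surjection $s$ is $(\mu^{(k_1)}\otimes\cdots\otimes\mu^{(k_m)})\circ\tau_s\circ\Delta^{(n)}\in\mathcal{S}(1,m)$, where $\tau_s$ sends the $i$-th output of $\Delta^{(n)}$ to the $j$-th input of $\mu^{(k_{s(i)})}$, $j$ the position of $i$ in the ordered set $s^{-1}(s(i))$. The Surjection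 operad $Sur$: $Sur(m)$ is the quotient of the dg $\mathbb{F}_2$-module with basis all functions $s:\{1,\dots,n\}\to\{1,\dots,m\}$ ($n\ge1$, degree $n-m$, $\partial s=\sum_j s\circ\iota_j$ with $\iota_j$ the order-preserving injection missing $j$) by the span of non-surjective $s$ and of $s$ with $s(i)=s(i+1)$ for some $i$; $\Sigma_m$ acts by postcomposition; for $s'\in Sur(m')$ in which $r$ occurs at positions $i_1<\dots<i_k$ and $s\in Sur(m)$ of length $n$, $s'\circ_r s$ is the sum over $1=j_0\le j_1\le\dots\le j_k=n$ of the sequence obtained from $(s'(1),\dots,s'(n'))$ by replacing the entry at position $i_t$ by $(s(j_{t-1}),\dots,s(j_t))$ with entries raised by $r-1$, and raising entries $>r$ of $s'$ by $m-1$. $\Psi:U(\mathcal{MS})\to Sur$ is the operad isomorphism sending the class of a surjection-like element to its associated surjection. Chains: $\mathrm{C}_\bullet(\Delta^d)$ has basis $[v_0,\dots,v_q]$, $0\le v_0<\dots<v_q\le d$ (symbols with repeated vertices are $0$). $\varphi_d:\mathcal{S}\to\mathrm{End}(\mathrm{C}_\bullet(\Delta^d))$ is the prop morphism sending $\varepsilon$ to the augmentation, $\Delta$ to the Alexander–Whitney map $[v_0,\dots,v_q]\mapsto\sum_i[v_0,\dots,v_i]\otimes[v_i,\dots,v_q]$, and $\mu$ to the join $[v_0,\dots,v_p]\otimes[v_{p+1},\dots,v_q]\mapsto[\text{the vertices } v_0,\dots,v_q \text{ in increasing order}]$ if they are pairwise distinct and $0$ otherwise (signs irrelevant over $\mathbb{F}_2$).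 The Sur-coalgebra $\phi_d:Sur\to\mathrm{End}(\mathrm{C}_\bullet(\Delta^d))$: for $s=(s(1),\dots,s(n))\in Sur(m)$ and $\sigma=[v_0,\dots,v_d]$, $\phi_d(s)(\sigma)=\sum_I\sigma^1_I\otimes\cdots\otimes\sigma^m_I$, summed over $I=(i_0,\dots,i_n)$ with $0=i_0\le i_1\le\dots\le i_n=d$, where for $s^{-1}(r)=\{j_1<\dots<j_k\}$, $\sigma^r_I=[v_{i_{j_1-1}},\dots,v_{i_{j_1}},v_{i_{j_2-1}},\dots,v_{i_{j_2}},\dots,v_{i_{j_k-1}},\dots,v_{i_{j_k}}]$ if all these vertices are distinct and $0$ otherwise (on faces of $\Delta^d$ similarly). For a simplicial set $X$, $U(\varphi)_X$ and $\phi_X$ are the operad morphisms induced from the natural families $\{\varphi_d|_{U(\mathcal{S})}\}$ and $\{\phi_d\}$ by Kan extension: for a $d$-simplex $\sigma:\Delta^d\to X$ and an operation $x$ of arity $m$, $x(\sigma)=(\sigma_* )^{\otimes m}\big(x_d[0,\dots,d]\big)$. *)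

(* Defs.v *)
(* Coefficients are F_2, encoded by parity of multiplicities. *)
From mathcomp Require Import all_boot all_fingroup.
From mathcomp Require Import boolp.
From Stdlib Require List.

Set Implicit Arguments.
Unset Strict Implicit.
Unset Printing Implicit Defensive.

(* sact is given on all functions, but only its values on monotone maps     *)
(* carry meaning (every simplicial set extends to such a record).           *)

Definition monotone (m n : nat) (f : 'I_m.+1 -> 'I_n.+1) : Prop :=
  forall i j : 'I_m.+1, (i <= j)%N -> (f i <= f j)%N.

Record sSet := SSet {
  sobj :> nat -> Type;
  sact : forall n m : nat, ('I_m.+1 -> 'I_n.+1) -> sobj n -> sobj m;
  sact_ext : forall n m (f g : 'I_m.+1 -> 'I_n.+1) x,
      (forall i, f i = g i) -> sact f x = sact g x;
  sact_id : forall n x, @sact n n id x = x;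
  sact_comp : forall n m p (f : 'I_m.+1 -> 'I_n.+1) (g : 'I_p.+1 -> 'I_m.+1) x,
      monotone f -> monotone g -> sact g (sact f x) = sact (f \o g) x
}.

Definition cell (X : sSet) := {n : nat & X n}.

Definition degenerate (X : sSet) (c : cell X) : Prop :=
  exists (k : nat) (f : 'I_(projT1 c).+1 -> 'I_k.+1) (y : X k),
    (k < projT1 c)%N /\ monotone f /\ projT2 c = sact f y.

(* An element of C_.(X)^{(x)m} is a formal sum (list) of elementary tensors *)
(* (lists of m simplices); coefficients are taken mod 2, and elementary     *)
(* tensors with a degenerate factor are zero.                               *)

Definition Tens (X : sSet) := seq (seq (cell X)).

Definition tcoef (X : sSet) (v : Tens X) (b : seq (cell X)) : bool :=
  odd (count (fun a => `[< a = b >]) v).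

Definition teq (X : sSet) (u v : Tens X) : Prop :=
  forall b : seq (cell X), (forall c, List.In c b -> ~ degenerate c) ->
    tcoef u b = tcoef v b.

(* A linear map C_.(X) -> C_.(X)^{(x)m}, given by its values on simplices. *)
Definition Op (X : sSet) := cell X -> Tens X.

Definition opeq (X : sSet) (f g : Op X) : Prop :=
  forall c : cell X, ~ degenerate c -> teq (f c) (g c).

(* Partial composition  f o_r g = (id^{r} (x) g (x) id) o f   (r 0-based). *)
Definition end_comp (X : sSet) (r : nat) (f g : Op X) : Op X :=
  fun c => flatten [seq match onth b r with
                       | Some cr => if `[< degenerate cr >] then [::]
                                    else [seq take r b ++ b' ++ drop r.+1 b | b' <- g cr]
                       | None => [::]
                       end | b <- f c].

(* Left Sigma_m action: the factor in position i is moved to position sigma i. *)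
Definition tperm_tuple (T : Type) (m : nat) (s : 'S_m) (b : seq T) : seq T :=
  pmap (fun j : 'I_m => onth b ((s^-1)%g j)) (enum 'I_m).

Definition end_act (X : sSet) (m : nat) (s : 'S_m) (f : Op X) : Op X :=
  fun c => [seq tperm_tuple s b | b <- f c].

Definition face (X : sSet) (d : nat) (x : X d) (v : seq nat) : cell X :=
  existT (fun n => X n) (size v).-1
    (sact (fun i : 'I_(size v).-1.+1 => (inord (nth 0 v i) : 'I_d.+1)) x).

(* Kan extension of a natural family given by its values x_d[0,...,d]
   (formal sums of elementary tensors of vertex lists in Delta^d). *)
Definition kan (X : sSet) (F : nat -> seq (seq (seq nat))) : Op X :=
  fun c => let: existT d x := c in [seq [seq face x v | v <- t] | t <- F d].

(* The prop morphism phi_d on surjection-like elements, evaluated on        *)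
(* [0,...,d]:  (mu^(k_1) (x) ... (x) mu^(k_m)) o tau_s o Delta^(n).          *)
(* Surjections s : {1..n} -> {1..m} are lists of values in 1..m.            *)

Definition is_surj (m : nat) (s : seq nat) : bool :=
  [&& (0 < size s)%N, all (fun v => (0 < v <= m)%N) s & all (fun r => r \in s) (iota 1 m)].

Definition aw (v : seq nat) : seq (seq nat * seq nat) :=
  [seq (take i.+1 v, drop i v) | i <- iota 0 (size v)].

(* Dit n = Delta^(n+1), with Delta^(1) = id, Delta^(k+1) = (Delta^(k) (x) id) o Delta. *)
Fixpoint Dit (n : nat) (v : seq nat) : seq (seq (seq nat)) :=
  match n with
  | 0 => [:: [:: v]]
  | n'.+1 => flatten [seq [seq rcons t p.2 | t <- Dit n' p.1] | p <- aw v]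
  end.

(* Join of two simplices of Delta^d (zero = None if vertices repeat). *)
Definition join (a b : seq nat) : option (seq nat) :=
  if uniq (a ++ b) then Some (sort leq (a ++ b)) else None.

Definition mu_it (ws : seq (seq nat)) : option (seq nat) :=
  match ws with
  | [::] => None
  | w :: ws' => foldl (fun acc b => obind (fun a => join a b) acc) (Some w) ws'
  end.

Fixpoint osequence (A : Type) (l : seq (option A)) : option (seq A) :=
  match l with
  | [::] => Some [::]
  | o :: l' => obind (fun a => omap (cons a) (osequence l')) o
  end.

Definition blocks (m : nat) (s : seq nat) (t : seq (seq nat)) : seq (seq (seq nat)) :=
  [seq [seq nth [::] t i.-1 | i <- iota 1 (size s) & nth 0 s i.-1 == r] | r <- iota 1 m].

Definition surjlike_top (m : nat) (s : seq nat) (d : nat) : seq (seq (seq nat)) :=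
  pmap (fun t => osequence [seq mu_it bl | bl <- blocks m s t])
       (Dit (size s).-1 (iota 0 d.+1)).

Fixpoint wincr (k a b : nat) : seq (seq nat) :=
  match k with
  | 0 => [:: [::]]
  | k'.+1 => flatten [seq [seq i :: l | l <- wincr k' i b] | i <- iota a (b.+1 - a)]
  end.

Definition phi_top (m : nat) (s : seq nat) (d : nat) : seq (seq (seq nat)) :=
  if is_surj m s then
    let n := size s in
    [seq tI <- [seq let I := 0 :: rcons l d in
                    [seq flatten [seq iota (nth 0 I j.-1) (nth 0 I j - nth 0 I j.-1).+1
                                 | j <- iota 1 n & nth 0 s j.-1 == r]
                    | r <- iota 1 m]
               | l <- wincr n.-1 0 d]
      | all uniq tI]
  else [::].

Definition phiX (X : sSet) (m : nat) (x : seq (seq nat)) : Op X :=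
  fun c => flatten [seq kan (X:=X) (phi_top m s) c | s <- x].

Definition jseqs (k n : nat) : seq (seq nat) :=
  if k is k'.+1 then [seq 1 :: rcons l n | l <- wincr k' 1 n]
  else if n == 1 then [:: [:: 1]] else [::].

Fixpoint subst_r (r m : nat) (chunks : seq (seq nat)) (s' : seq nat) : seq nat :=
  match s' with
  | [::] => [::]
  | a :: s'' =>
      if a == r then head [::] chunks ++ subst_r r m (behead chunks) s''
      else (if (r < a)%N then a + m.-1 else a) :: subst_r r m chunks s''
  end.

(* s' o_r s  for single surjections (r 1-based), s of arity m. *)
Definition sur_comp1 (r m : nat) (s' s : seq nat) : seq (seq nat) :=
  let k := count_mem r s' in
  [seq subst_r r m
       [seq map (addn r.-1) (take (nth 0 j t - nth 0 j t.-1).+1 (drop (nth 0 j t.-1).-1 s))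
       | t <- iota 1 k] s'
  | j <- jseqs k (size s)].

Definition sur_comp (r m : nat) (x y : seq (seq nat)) : seq (seq nat) :=
  flatten [seq flatten [seq sur_comp1 r m a b | b <- y] | a <- x].

Definition sur_act (m : nat) (sg : 'S_m) (s : seq nat) : seq nat :=
  [seq oapp (fun i : 'I_m => (sg i).+1) v (insub v.-1) | v <- s].

(* Elements of the suboperad U(Sh) generated by the surjection-like         *)
(* elements: formal operad expressions in those generators (generator for   *)
(* every surjection s), closed under partial composition, Sigma-action and  *)
(* F_2-linear combinations.                                                 *)

Inductive sterm : nat -> Type :=
| SGen (m : nat) (s : seq nat) : is_surj m s -> sterm m
| SComp (m' m : nat) (r : 'I_m') : sterm m' -> sterm m -> sterm (m' + m).-1
| SAct (m : nat) : 'S_m -> sterm m -> sterm m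
| SSum (m : nat) : sterm m -> sterm m -> sterm m
| SZero (m : nat) : sterm m.

(* Psi(q(x)) in Sur(m) (as a representative formal sum). *)
Fixpoint evalSur (m : nat) (t : sterm m) : seq (seq nat) :=
  match t with
  | SGen _ s _ => [:: s]
  | SComp _ m r t u => sur_comp r.+1 m (evalSur t) (evalSur u)
  | SAct _ sg t => map (sur_act sg) (evalSur t)
  | SSum _ t u => evalSur t ++ evalSur u
  | SZero _ => [::]
  end.

Fixpoint evalEnd (X : sSet) (m : nat) (t : sterm m) : Op X :=
  match t with
  | SGen m s _ => kan (X:=X) (surjlike_top m s)
  | SComp _ _ r t u => end_comp r (@evalEnd X _ t) (@evalEnd X _ u)
  | SAct _ sg t => end_act sg (@evalEnd X _ t)
  | SSum _ t u => fun c => @evalEnd X _ t c ++ @evalEnd X _ u c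
  | SZero _ => fun _ => [::]
  end.

Arguments evalEnd X {m} t.
Arguments phiX X m x _ : clear implicits.

(* Main.v *)
(* Cutting a vertex list v into overlapping pieces labelled by a sequence s is
   the same as a monotone lattice path in the grid s x v. Summands of the
   iterated Alexander-Whitney map, of the interval-cut formula for the
   surjection action, and of the composition of surjections are all such paths.
   A pair of paths, one for s' and one for s on the vertices that s' labels r,
   merges into a path for one of the summands of s' o_r s, and this is a
   bijection (cutw_shuf). Vanishing of summands also matches: if the r-th factor
   repeats a vertex, then so does a factor of the merged path, and a degenerate
   r-th factor makes some factor of every summand degenerate. *)
Require Import Defs.
From mathcomp Require Import all_boot all_fingroup.
From mathcomp Require Import boolp.
From mathcomp Require Import zify.

Set Implicit Arguments.
Unset Strict Implicit.
Unset Printing Implicit Defensive.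

(** Each bijection is an equality of sums of an arbitrary [nat]-valued function over two lists: it
    is then proved by recursion on the summands, with no inverse map to write and with
    multiplicities kept. Paths are merged without regard to repeated vertices, which the recursion
    cannot see; distinctness is imposed only on the final factors. The obstacle is that composition
    in [End] evaluates the inner operation on the r-th factor as a simplex of its own, renumbered
    from 0 and set to zero when degenerate in [X], while a composite of surjections sees only the
    vertices of the original simplex. *)

(** * Test sums and splittings of the iterated Alexander-Whitney map *)

Lemma sum_flatten_map (A B : Type) (f : A -> seq B) (l : seq A) (F : B -> nat) :
  \sum_(x <- flatten [seq f y | y <- l]) F x = \sum_(y <- l) \sum_(x <- f y) F x.
Proof. by rewrite big_flatten big_map. Qed.

Lemma sum_eq_perm (T : eqType) (l l' : seq T) :
  (forall F : T -> nat, \sum_(x <- l) F x = \sum_(x <- l') F x) -> perm_eq l l'.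
Proof.
move=> H; apply/seq.permP => P.
by rewrite -!sumn_count !sumnE !big_map (H (fun x => nat_of_bool (P x))).
Qed.

Lemma aw_cons a v :
  aw (a :: v) = ([:: a], a :: v) :: [seq (a :: p.1, p.2) | p <- aw v].
Proof.
rewrite /aw [size _]/= -[(size v).+1]add1n iotaD /= take0; congr (_ :: _).
by rewrite (iotaDl 1 0) -!map_comp.
Qed.

Lemma sum_aw_cons a v (F : seq nat * seq nat -> nat) :
  \sum_(p <- aw (a :: v)) F p =
  F ([:: a], a :: v) + \sum_(p <- aw v) F (a :: p.1, p.2).
Proof. by rewrite aw_cons big_cons big_map. Qed.

(** Coassociativity: both sides run over two cut positions in weakly increasing order and differ
    only in which one is chosen first. *)
Lemma aw_coassoc v (F : seq nat -> seq nat -> seq nat -> nat) :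
  \sum_(p <- aw v) \sum_(q <- aw p.1) F q.1 q.2 p.2 =
  \sum_(q <- aw v) \sum_(p <- aw q.2) F q.1 p.1 p.2.
Proof.
elim: v F => [|a v IH] F; first by rewrite !big_nil.
rewrite !sum_aw_cons /= ?sum_aw_cons /= -(IH (fun x => F (a :: x))) big_nil addn0 -addnA.
congr (_ + _).
rewrite -big_split /=; apply: eq_bigr => p _.
by rewrite sum_aw_cons.
Qed.

Lemma sum_aw_end v (F : seq nat -> nat) : v != [::] ->
  \sum_(p <- aw v) (if size p.2 == 1 then F p.1 else 0) = F v.
Proof.
elim: v F => // a [|b v] IH F _; rewrite sum_aw_cons /=; first by rewrite big_nil addn0.
by rewrite (IH (fun w => F (a :: w))).
Qed.

Lemma aw_cat v p : p \in aw v -> v = p.1 ++ behead p.2.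
Proof.
by case/mapP=> i _ ->; rewrite /= -drop1 drop_drop add1n cat_take_drop.
Qed.

Lemma aw_nil1 v p : p \in aw v -> p.1 != [::].
Proof.
by case/mapP=> i; rewrite mem_iota => /andP[_]; case: v => // a v _ ->.
Qed.

Lemma aw_nil2 v p : p \in aw v -> p.2 != [::].
Proof.
case/mapP=> i; rewrite mem_iota => /andP[_ lti] -> /=.
by rewrite -size_eq0 size_drop subn_eq0 -ltnNge; move: lti; rewrite add0n.
Qed.

Lemma aw_sub1 v p : p \in aw v -> {subset p.1 <= v}.
Proof. by case/mapP=> i _ -> x; apply: mem_take. Qed.

Lemma aw_sub2 v p : p \in aw v -> {subset p.2 <= v}.
Proof. by case/mapP=> i _ -> x; apply: mem_drop. Qed.

Lemma aw_sorted v p : sorted leq v -> p \in aw v ->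
  [/\ sorted leq p.1, sorted leq p.2 & allrel leq p.1 p.2].
Proof.
move=> sv /mapP[/= i]; rewrite mem_iota => /andP[_ lti] -> /=.
split; [exact: take_sorted | exact: drop_sorted | apply/allrelP => /= x y].
have {}lti : i < size v := lti.
move=> /(nthP 0)[/= j]; rewrite size_takel // => ltj <-.
move=> /(nthP 0)[/= k]; rewrite size_drop => ltk <-.
rewrite nth_take ?nth_drop //.
apply: (sorted_leq_nth leq_trans leqnn) => //; rewrite ?inE; lia.
Qed.

Lemma aw_ltn_sorted v p : p \in aw v ->
  sorted ltn p.1 -> sorted ltn p.2 -> sorted ltn v.
Proof.
elim: v p => // a v IH p; rewrite aw_cons inE => /orP[/eqP-> //|/mapP[q qv ->]] /=.
have := IH q qv; have := aw_cat qv; have := aw_nil1 qv.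
case: q.1 => // b w _ -> /= Hq /andP[-> s1] s2 /=; exact: Hq.
Qed.

(** [Dit] splits off its last factor; by coassociativity the first can be split off instead, which
    is the recursion that [cutw] follows. *)
Lemma Dit_left n v (F : seq (seq nat) -> nat) :
  \sum_(t <- Dit n.+1 v) F t =
  \sum_(p <- aw v) \sum_(t <- Dit n p.2) F (p.1 :: t).
Proof.
elim: n v F => [|n IH] v F.
  rewrite /= sum_flatten_map; apply: eq_bigr => p _.
  by rewrite !big_seq1.
rewrite -[Dit n.+2 v]/(flatten [seq [seq rcons t p.2 | t <- Dit n.+1 p.1] | p <- aw v]).
rewrite sum_flatten_map.
under eq_bigr do rewrite big_map IH.
rewrite (aw_coassoc v (fun x y z => \sum_(t <- Dit n y) F (rcons (x :: t) z))).
apply: eq_bigr => q _; rewrite /= sum_flatten_map.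
by apply: eq_bigr => p _; rewrite big_map.
Qed.

Lemma size_Dit n v t : t \in Dit n v -> size t = n.+1.
Proof.
elim: n v t => [|n IH] v t /=; first by rewrite inE => /eqP->.
by case/flattenP=> _ /mapP[p _ ->] /mapP[u /IH <- ->]; rewrite size_rcons.
Qed.

Lemma Dit_sub n v t : t \in Dit n v -> {subset flatten t <= v}.
Proof.
elim: n v t => [|n IH] v t /=; first by rewrite inE => /eqP->; rewrite /= cats0.
case/flattenP=> _ /mapP[p pv ->] /mapP[u /IH Hu ->] x.
rewrite flatten_rcons mem_cat => /orP[/Hu|]; [exact: aw_sub1 | exact: aw_sub2].
Qed.

Lemma Dit_sorted n v t : sorted leq v -> t \in Dit n v -> sorted leq (flatten t).
Proof.
elim: n v t => [|n IH] v t sv /=; first by rewrite inE => /eqP->; rewrite /= cats0.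
case/flattenP=> _ /mapP[p pv ->] /mapP[u Hu ->].
have [s1 s2 rel] := aw_sorted sv pv.
rewrite flatten_rcons (sorted_pairwise leq_trans) pairwise_cat.
rewrite -!(sorted_pairwise leq_trans) s2 (IH _ _ s1 Hu) !andbT.
by apply/allrelP => x y /(Dit_sub Hu) xp yp; apply: (allrelP rel).
Qed.

(** * Labelled lattice paths and their factors *)

(* Words of pairs (label, vertex): [v] is cut into [size s] overlapping pieces
   and the vertices of the i-th piece are labelled by the i-th entry of [s];
   equivalently, monotone lattice paths in the grid [s] x [v]. *)
Fixpoint cutw (A : Type) (s : seq A) (v : seq nat) : seq (seq (A * nat)) :=
  match s with
  | [::] => if size v == 1 then [:: [::]] else [::]
  | x :: s' => flatten [seq [seq [seq (x, b) | b <- p.1] ++ W | W <- cutw s' p.2]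
                       | p <- aw v]
  end.

Lemma sum_cutw_cons (A : Type) (x : A) s v (F : seq (A * nat) -> nat) :
  \sum_(W <- cutw (x :: s) v) F W =
  \sum_(p <- aw v) \sum_(W <- cutw s p.2) F ([seq (x, b) | b <- p.1] ++ W).
Proof. by rewrite /= sum_flatten_map; apply: eq_bigr => p _; rewrite big_map. Qed.

Lemma cutw_nil (A : Type) (s : seq A) : cutw s [::] = [::].
Proof. by case: s. Qed.

(** One step of the path from the corner [(x, a)]: to the next label at the same vertex, or to the
    next vertex under the same label. *)
Lemma sum_cutw_step (A : Type) (x : A) s a v (F : seq (A * nat) -> nat) :
  \sum_(W <- cutw (x :: s) (a :: v)) F W =
  \sum_(W <- cutw s (a :: v)) F ((x, a) :: W) +
  \sum_(W <- cutw (x :: s) v) F ((x, a) :: W).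
Proof. by rewrite !sum_cutw_cons sum_aw_cons. Qed.

(** Transposing the grid exchanges the two kinds of steps. Both axes are nonempty because the base
    case of [cutw] is asymmetric: an empty label list may meet one last vertex, but not
    conversely. *)
Lemma cutw_swap (x : nat) s a v (F : seq (nat * nat) -> nat) :
  \sum_(W <- cutw (a :: v) (x :: s)) F [seq (p.2, p.1) | p <- W] =
  \sum_(W <- cutw (x :: s) (a :: v)) F W.
Proof.
have [n] := ubnP (size s + size v); elim: n x s a v F => // n IH x s a v F ltn.
rewrite (sum_cutw_step a) (sum_cutw_step x).
case: s v ltn => [|y s] [|b v] ltn; rewrite ?cutw_nil ?[cutw [::] _]/= ?big_nil ?addn0 ?add0n.
- by rewrite !big_seq1.
- exact: (IH x [::] b v (fun W => F ((x, a) :: W))).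
- apply: (IH y s a [::] (fun W => F ((x, a) :: W))); move: ltn => /=; lia.
rewrite addnC; congr (_ + _).
  apply: (IH y s a (b :: v) (fun W => F ((x, a) :: W))); move: ltn => /=; lia.
apply: (IH x (y :: s) b v (fun W => F ((x, a) :: W))); move: ltn => /=; lia.
Qed.

Lemma cutwP (A : eqType) (x : A) s v W : W \in cutw (x :: s) v ->
  exists2 p, p \in aw v &
  exists2 W', W' \in cutw s p.2 & W = [seq (x, b) | b <- p.1] ++ W'.
Proof.
by case/flattenP=> _ /mapP[p pv ->] /mapP[W' W'p ->]; exists p => //; exists W'.
Qed.

Lemma cutw_sub (A : eqType) (s : seq A) v W :
  W \in cutw s v -> {subset map snd W <= v}.
Proof.
elim: s v W => [|x s IH] v W /=; first by case: eqP => // _; rewrite inE => /eqP->.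
case/cutwP=> p pv [W' /IH W'p ->] y.
rewrite map_cat -map_comp map_id mem_cat => /orP[|/W'p]; first exact: aw_sub1.
exact: aw_sub2.
Qed.

Lemma cutw_sorted (A : eqType) (s : seq A) v W :
  sorted leq v -> W \in cutw s v -> sorted leq (map snd W).
Proof.
elim: s v W => [|x s IH] v W sv /=; first by case: eqP => // _; rewrite inE => /eqP->.
case/cutwP=> p pv [W' W'p ->].
have [s1 s2 rel] := aw_sorted sv pv.
rewrite map_cat -map_comp map_id (sorted_pairwise leq_trans) pairwise_cat.
rewrite -!(sorted_pairwise leq_trans) s1 (IH _ _ s2 W'p) !andbT.
by apply/allrelP => y z yp /(cutw_sub W'p) zp; apply: (allrelP rel).
Qed.

Definition fac (A : eqType) (r : A) (W : seq (A * nat)) : seq nat :=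
  [seq p.2 | p <- W & p.1 == r].

Lemma fac_cat (A : eqType) (r : A) W W' : fac r (W ++ W') = fac r W ++ fac r W'.
Proof. by rewrite /fac filter_cat map_cat. Qed.

Lemma fac_label (A : eqType) (r x : A) w :
  fac r [seq (x, b) | b <- w] = if x == r then w else [::].
Proof.
rewrite /fac; elim: w => [|b w IH] /=; first by case: eqP.
by case: eqP IH => //= _ ->.
Qed.

Lemma fac_subseq (A : eqType) (r : A) W : subseq (fac r W) (map snd W).
Proof. exact/map_subseq/filter_subseq. Qed.

Lemma cutw_fac_nil (A : eqType) (s : seq A) v W x :
  W \in cutw s v -> x \in s -> fac x W != [::].
Proof.
elim: s v W => // y s IH v W /cutwP[p /aw_nil1 pv [W' W'p ->]].
rewrite fac_cat fac_label inE eq_sym => /orP[->|/(IH _ _ W'p)].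
  by case: p.1 pv.
by rewrite -!size_eq0 size_cat addn_eq0 negb_and => ->; rewrite orbT.
Qed.

(** The cut vertex is copied to both sides, so a cut never separates two neighbours: both lie in the
    first piece or both survive in the remainder. *)
Lemma cutw_adjacent (A : eqType) (s : seq A) v1 a b v2 W :
  W \in cutw s (v1 ++ [:: a, b & v2]) ->
  exists2 x, x \in s & (a \in fac x W) && (b \in fac x W).
Proof.
have Haw v p : p \in aw (v ++ [:: a, b & v2]) ->
    (a \in p.1) && (b \in p.1) \/ exists u, p.2 = u ++ [:: a, b & v2].
  elim: v p => [|c v IH] p.
    rewrite cat0s aw_cons inE => /orP[/eqP->|/mapP[q + ->]]; first by right; exists [::].
    rewrite aw_cons inE => /orP[/eqP->|/mapP[q' _ ->]]; left;
      by rewrite /= !inE !eqxx ?orbT.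
  rewrite cat_cons aw_cons inE => /orP[/eqP->|/mapP[q /IH Hq ->]].
    by right; exists (c :: v).
  case: Hq => [/andP[q1 q2]|]; last by right.
  by left; rewrite /= !inE q1 q2 !orbT.
elim: s v1 W => [|x s IH] v1 W; first by rewrite /= size_cat !addnS.
case/cutwP=> p /Haw Hp [W' W'p ->]; case: Hp => [/andP[pa pb]|[u pu]].
  by exists x; rewrite ?mem_head // fac_cat fac_label eqxx !mem_cat pa pb.
move: W'p; rewrite pu => /IH[y ys /andP[ya yb]].
by exists y; rewrite ?inE ?ys ?orbT // fac_cat !mem_cat ya yb !orbT.
Qed.

(* Two consecutive entries of [v] always share a piece, so a repetition in the
   sorted list [v] shows up inside one of the factors. *)
Lemma cutw_uniq (A : eqType) (s : seq A) v W : sorted leq v -> W \in cutw s v ->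
  {in s, forall x, uniq (fac x W)} -> uniq v.
Proof.
move=> sv Ws H; suff: sorted ltn v by rewrite ltn_sorted_uniq_leq => /andP[].
elim: s v W sv Ws H => [|x s IH] v W sv.
  by case: v sv => [|a [|b v]].
case/cutwP=> p pv [W' W'p ->] H; have [s1 s2 _] := aw_sorted sv pv.
have sub y : y \in s -> uniq (fac y W').
  by move=> ys; have := H y (@mem_behead _ (x :: s) y ys);
    rewrite fac_cat cat_uniq => /and3P[].
apply: (aw_ltn_sorted pv); last exact: IH W'p sub.
have := H x (mem_head _ _); rewrite fac_cat fac_label eqxx cat_uniq => /andP[u1 _].
by rewrite ltn_sorted_uniq_leq u1.
Qed.

(** * Composition of label sequences as merging of paths *)

(* Label sequences of partial compositions [s' o_r s]: the entries of [s']
   different from [r] are kept with tag [inl], the occurrences of [r] are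
   replaced by overlapping pieces of [s], with tag [inr]. *)
Fixpoint shuf (r : nat) (s' s : seq nat) : seq (seq (nat + nat)) :=
  match s' with
  | [::] => if size s == 1 then [:: [::]] else [::]
  | y :: s1 =>
    if y == r
    then flatten [seq [seq map inr p.1 ++ z | z <- shuf r s1 p.2] | p <- aw s]
    else [seq inl y :: z | z <- shuf r s1 s]
  end.

Lemma shuf_nil r s' : shuf r s' [::] = [::].
Proof. by elim: s' => //= y s1 ->; case: ifP. Qed.

Lemma sum_shuf_cons r s1 s (F : seq (nat + nat) -> nat) :
  \sum_(z <- shuf r (r :: s1) s) F z =
  \sum_(p <- aw s) \sum_(z <- shuf r s1 p.2) F (map inr p.1 ++ z).
Proof.
by rewrite /= eqxx sum_flatten_map; apply: eq_bigr => p _; rewrite big_map.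
Qed.

Lemma sum_shuf_step r s1 x s (F : seq (nat + nat) -> nat) :
  \sum_(z <- shuf r (r :: s1) (x :: s)) F z =
  \sum_(z <- shuf r s1 (x :: s)) F (inr x :: z) +
  \sum_(z <- shuf r (r :: s1) s) F (inr x :: z).
Proof. by rewrite !sum_shuf_cons sum_aw_cons. Qed.

(** The part of a path for [s'] that inserting [s] leaves untouched; [outl] and [outr] recover this
    part and the inner path from a merged path. *)
Definition unm (r : nat) (W : seq (nat * nat)) := [seq p <- W | p.1 != r].

Definition outl (U : seq ((nat + nat) * nat)) : seq (nat * nat) :=
  pmap (fun p => if p.1 is inl y then Some (y, p.2) else None) U.

Definition outr (U : seq ((nat + nat) * nat)) : seq (nat * nat) :=
  pmap (fun p => if p.1 is inr x then Some (x, p.2) else None) U.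

(* Both sides satisfy the same recursion on the first step of the lattice
   paths; on the left, the word in the grid [s] x [fac r W'] is
   transposed so that it extends to the case where no vertex labelled [r]
   is left. *)
Lemma cutw_shuf_transposed r s' s v (K : seq (nat * nat) -> seq (nat * nat) -> nat) :
  \sum_(W' <- cutw s' v) \sum_(W <- cutw (fac r W') s)
     K (unm r W') [seq (p.2, p.1) | p <- W] =
  \sum_(z <- shuf r s' s) \sum_(U <- cutw z v) K (outl U) (outr U).
Proof.
have [n] := ubnP (size s' + size s + size v).
elim: n s' s v K => // n IH [|y s1] s v K ltn.
  rewrite /=; case: ifP => vs; last first.
    by rewrite big_nil; case: ifP => _; rewrite ?big_nil // big_seq1 /= vs big_nil.
  rewrite big_seq1 /=; case: ifP => ss; last by rewrite !big_nil.
  by rewrite !big_seq1 /= vs big_seq1.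
case: v ltn => [|a v] ltn.
  by rewrite cutw_nil big_nil big1 // => z _; rewrite cutw_nil big_nil.
have IHn t' t w K' : size t' + size t + size w < size (y :: s1) + size s + size (a :: v) ->
    \sum_(W' <- cutw t' w) \sum_(W <- cutw (fac r W') t)
       K' (unm r W') [seq (p.2, p.1) | p <- W] =
    \sum_(z <- shuf r t' t) \sum_(U <- cutw z w) K' (outl U) (outr U).
  by move=> lt1; apply: IH; apply: leq_trans lt1 _; rewrite -ltnS.
rewrite sum_cutw_step; case: (eqVneq y r) => [yr|yr].
  subst y; case: s ltn IHn => [|x s] ltn IHn.
    rewrite shuf_nil big_nil !big1 // => W' _.
      by rewrite /fac /= eqxx /= big_nil.
    by rewrite /fac /= eqxx /= big_nil.
  have facE W' : fac r ((r, a) :: W') = a :: fac r W' by rewrite /fac /= eqxx.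
  have unmE W' : unm r ((r, a) :: W') = unm r W' by rewrite /unm /= eqxx.
  under eq_bigr do rewrite facE unmE sum_cutw_step.
  under [X in _ + X = _]eq_bigr do rewrite facE unmE sum_cutw_step.
  (* From the corner [(r, x, a)] a merged path advances in [s'], in [s] or in the vertices, and each
     move is one use of the induction hypothesis. The move in [s] is spread over two summands on the
     left, the move in the vertices over two on the right. *)
  pose K' A B := K A ((x, a) :: B).
  have lt1 : size (r :: s1) + size s + size (a :: v) <
      size (r :: s1) + size (x :: s) + size (a :: v) by rewrite /= ?addnS ?addSn.
  have := IHn (r :: s1) s (a :: v) K' lt1.
  rewrite sum_cutw_step.
  under eq_bigr do rewrite facE unmE.
  under [X in _ + X = _ -> _ = _]eq_bigr do rewrite facE unmE.
  rewrite /= => H1; rewrite !big_split /= addnACA.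
  rewrite H1.
  rewrite sum_shuf_step.
  under [X in _ = X + _]eq_bigr do rewrite sum_cutw_step.
  under [X in _ = _ + X]eq_bigr do rewrite sum_cutw_step.
  rewrite !big_split /=.
  have H2 := IHn s1 (x :: s) (a :: v) K'; rewrite /K' /= in H2.
  rewrite H2; last by rewrite ?addnS ?addSn.
  have H3 := IHn (r :: s1) (x :: s) v (fun A B => K A ((x, a) :: B)).
  rewrite H3; last by rewrite /= ?addnS ?addSn.
  by rewrite sum_shuf_step -!addnA; congr (_ + (_ + _)); apply: addnC.
pose K' A B := K ((y, a) :: A) B.
have facE W' : fac r ((y, a) :: W') = fac r W' by rewrite /fac /= (negPf yr).
have unmE W' : unm r ((y, a) :: W') = (y, a) :: unm r W' by rewrite /unm /= yr.
under eq_bigr do rewrite facE unmE.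
under [X in _ + X = _]eq_bigr do rewrite facE unmE.
rewrite [shuf _ _ _]/= (negPf yr) big_map.
under [RHS]eq_bigr do rewrite sum_cutw_step.
rewrite big_split.
congr (_ + _); first by apply: (IHn _ _ _ K'); rewrite ?addnS ?addSn.
rewrite (IHn _ _ _ K'); last by rewrite /= ?addnS ?addSn.
by rewrite /= (negPf yr) big_map.
Qed.

(** An occurrence of [r] in [s'] makes [fac r W'] nonempty, so the inner grid may be transposed
    back. *)
Lemma cutw_shuf r s' s v (K : seq (nat * nat) -> seq (nat * nat) -> nat) :
  r \in s' -> s != [::] ->
  \sum_(W' <- cutw s' v) \sum_(W <- cutw s (fac r W')) K (unm r W') W =
  \sum_(z <- shuf r s' s) \sum_(U <- cutw z v) K (outl U) (outr U).
Proof.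
move=> rs' s0; rewrite -cutw_shuf_transposed; apply: eq_big_seq => W' /cutw_fac_nil/(_ rs').
case: s s0 => // x s _; case: (fac r W') => // a w _.
by rewrite (cutw_swap x s a w (K (unm r W'))).
Qed.

(** * Renaming of vertices and labels; interval cuts as paths *)

Lemma sum_aw_map (g : nat -> nat) v (F : seq nat * seq nat -> nat) :
  \sum_(p <- aw (map g v)) F p = \sum_(p <- aw v) F (map g p.1, map g p.2).
Proof.
elim: v F => [|a v IH] F; first by rewrite !big_nil.
by rewrite /= !sum_aw_cons IH.
Qed.

Lemma sum_cutw_map (A : Type) (s : seq A) (g : nat -> nat) v (F : seq (A * nat) -> nat) :
  \sum_(W <- cutw s (map g v)) F W =
  \sum_(W <- cutw s v) F [seq (p.1, g p.2) | p <- W].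
Proof.
elim: s v F => [|x s IH] v F.
  by rewrite /= size_map; case: ifP => _; rewrite ?big_nil ?big_seq1.
rewrite !sum_cutw_cons sum_aw_map; apply: eq_bigr => p _.
rewrite (IH _ (fun W => F ([seq (x, b) | b <- map g p.1] ++ W))).
by apply: eq_bigr => W _; rewrite map_cat -!map_comp.
Qed.

Lemma sum_cutw_label (A B : Type) (f : A -> B) (s : seq A) v (F : seq (B * nat) -> nat) :
  \sum_(W <- cutw (map f s) v) F W =
  \sum_(W <- cutw s v) F [seq (f p.1, p.2) | p <- W].
Proof.
elim: s v F => [|x s IH] v F.
  by rewrite /=; case: ifP => _; rewrite ?big_nil ?big_seq1.
rewrite [map _ _]/= !sum_cutw_cons; apply: eq_bigr => p _.
rewrite (IH _ (fun W => F ([seq (f x, b) | b <- p.1] ++ W))).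
by apply: eq_bigr => W _; rewrite map_cat -!map_comp.
Qed.

Lemma aw_iota a n : aw (iota a n) =
  [seq (iota a (i - a).+1, iota i (n - (i - a))) | i <- iota a n].
Proof.
rewrite /aw size_iota -[in RHS](addn0 a) iotaDl -map_comp addn0.
apply/eq_in_map => i; rewrite mem_iota => /andP[_ lti] /=.
by rewrite take_iota drop_iota addKn (minn_idPl lti) addnC.
Qed.

Definition interval a b := iota a (b - a).+1.

(** A weakly increasing sequence lists the [k] inner cut points of [k.+1] pieces. The parameters [g]
    and [pc] cover both uses: intervals of vertices, and chunks of a surjection. *)
Lemma sum_wincr_Dit (g : nat -> nat) (pc : nat -> nat -> seq nat) k a b
    (F : seq (seq nat) -> nat) : a <= b ->
  (forall i j, a <= i -> i <= j -> j <= b -> pc i j = map g (interval i j)) ->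
  \sum_(l <- wincr k a b) F
     [seq pc (nth 0 (a :: rcons l b) j.-1) (nth 0 (a :: rcons l b) j) | j <- iota 1 k.+1] =
  \sum_(t <- Dit k (map g (interval a b))) F t.
Proof.
elim: k a F => [|k IH] a F leab Hpc; first by rewrite !big_seq1 /= Hpc.
rewrite Dit_left sum_aw_map /interval aw_iota big_map.
rewrite [wincr _ _ _]/= sum_flatten_map subSn //; apply: eq_big_seq => i.
rewrite mem_iota => ib; have leib : i <= b by lia.
have leai : a <= i by lia.
have -> : (b - a).+1 - (i - a) = (b - i).+1 by lia.
have E : map g (iota a (i - a).+1) = pc a i by rewrite Hpc.
rewrite big_map [fst _]/= [snd _]/= E.
have {IH} := IH i (fun t => F (pc a i :: t)) leib.
rewrite /interval => <-; last by move=> *; apply: Hpc => //; lia.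
apply: eq_bigr => l _.
rewrite -[iota 1 k.+2]/(1 :: iota (1 + 1) k.+1) map_cons (iotaDl 1 1) -map_comp.
by congr (F (_ :: _)); apply/eq_in_map => j; rewrite mem_iota; case: j.
Qed.

Definition word (A : Type) (s : seq A) (t : seq (seq nat)) : seq (A * nat) :=
  flatten [seq [seq (p.1, b) | b <- p.2] | p <- zip s t].

(** The empty label list accepts only a single leftover vertex, so the last piece of a path runs to
    the end of [v], as the last factor of [Dit] does. *)
Lemma sum_Dit_word (A : Type) (x : A) s v (F : seq (A * nat) -> nat) : v != [::] ->
  \sum_(t <- Dit (size s) v) F (word (x :: s) t) = \sum_(W <- cutw (x :: s) v) F W.
Proof.
elim: s x v F => [|y s IH] x v F v0.
  rewrite big_seq1 sum_cutw_cons /word /= cats0.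
  rewrite -(sum_aw_end (fun w => F [seq (x, b) | b <- w]) v0).
  by apply: eq_bigr => p _; case: ifP => _; rewrite ?big_nil ?big_seq1 ?cats0.
rewrite [size _]/= Dit_left sum_cutw_cons; apply: eq_big_seq => p /aw_nil2 p0.
by rewrite -(IH y p.2 (fun W => F ([seq (x, b) | b <- p.1] ++ W))).
Qed.

Lemma fac_word (r : nat) (s : seq nat) t : size t = size s ->
  fac r (word s t) =
  flatten [seq nth [::] t i.-1 | i <- iota 1 (size s) & nth 0 s i.-1 == r].
Proof.
elim: s t => [|x s IH] [|w t] //= [st].
rewrite /word /= fac_cat fac_label -/(word s t) IH //.
have -> : [seq nth [::] t i.-1 | i <- iota 1 (size s) & nth 0 s i.-1 == r] =
    [seq nth [::] (w :: t) i.-1 | i <- iota 2 (size s) & nth 0 (x :: s) i.-1 == r].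
  rewrite (iotaDl 1 1) filter_map -map_comp.
  rewrite (@eq_in_filter _ (preim _ _) (fun i => nth 0 s i.-1 == r)); last first.
    by move=> i; rewrite mem_iota; case: i.
  by apply/eq_in_map => i; rewrite mem_filter mem_iota; case: i; rewrite ?andbF.
by case: eqP.
Qed.

Definition factors (m : nat) (W : seq (nat * nat)) : seq (seq nat) :=
  [seq fac r W | r <- iota 1 m].

Lemma blocks_word m s t : size t = size s ->
  [seq flatten bl | bl <- blocks m s t] = factors m (word s t).
Proof.
by move=> st; rewrite /blocks -map_comp; apply: eq_map => r /=; rewrite fac_word.
Qed.

Lemma iota_interval d : iota 0 d.+1 = interval 0 d.
Proof. by rewrite /interval subn0. Qed.

Lemma phi_top_Dit m s d (F : seq (seq nat) -> nat) : is_surj m s ->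
  \sum_(T <- phi_top m s d) F T =
  \sum_(t <- Dit (size s).-1 (iota 0 d.+1))
     let T := factors m (word s t) in if all uniq T then F T else 0.
Proof.
move=> sm; rewrite /phi_top sm big_filter big_map.
have s0 : 0 < size s by case/and3P: sm.
pose G t := let T := map flatten (blocks m s t) in if all uniq T then F T else 0.
have -> : \sum_(t <- Dit (size s).-1 (iota 0 d.+1))
    (let T := factors m (word s t) in if all uniq T then F T else 0) =
    \sum_(t <- Dit (size s).-1 (map id (interval 0 d))) G t.
  rewrite map_id -iota_interval; apply: eq_big_seq => t /size_Dit st.
  by rewrite /G blocks_word // st prednK.
rewrite -(@sum_wincr_Dit id interval) //; last by move=> *; rewrite map_id.
rewrite (prednK s0) big_mkcond; apply: eq_bigr => l _.
set I := 0 :: rcons l d.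
set T := [seq _ | r <- _].
suff -> : T = [seq flatten bl
    | bl <- blocks m s [seq interval (nth 0 I j.-1) (nth 0 I j) | j <- iota 1 (size s)]] by [].
rewrite /T /blocks -map_comp; apply: eq_map => r /=; congr flatten.
apply/eq_in_map => j; rewrite mem_filter mem_iota => /andP[_ /andP[j1 j2]].
rewrite (nth_map 0) ?size_iota; last by lia.
rewrite nth_iota; last by lia.
by rewrite add1n prednK.
Qed.

Lemma phi_top_cutw m s d : is_surj m s ->
  perm_eq (phi_top m s d)
    [seq T <- [seq factors m W | W <- cutw s (iota 0 d.+1)] | all uniq T].
Proof.
move=> sm; apply: sum_eq_perm => F; rewrite phi_top_Dit //.
by case: s sm => // x s _; rewrite big_filter big_map [RHS]big_mkcond -sum_Dit_word.
Qed.

(** * Iterated joins and the surjection-like generators *)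

Lemma osequence_map (A : eqType) (B : Type) (P : pred B) (f : A -> option B) (g : A -> B) l :
  {in l, forall x, f x = if P (g x) then Some (g x) else None} ->
  osequence (map f l) = if all P (map g l) then Some (map g l) else None.
Proof.
elim: l => //= x l IH H; rewrite H ?mem_head //.
case: ifP => //= _; rewrite IH; first by case: ifP.
by move=> y yl; apply: H; rewrite inE yl orbT.
Qed.

(** The pieces arrive in increasing order, so the sorting in [join] does nothing, and a repetition
    at any stage persists in the full concatenation. A lone piece is not tested by [mu_it], whence
    [uniq w]. *)
Lemma mu_it_flatten w ws : uniq w -> sorted leq (flatten (w :: ws)) ->
  mu_it (w :: ws) =
  if uniq (flatten (w :: ws)) then Some (flatten (w :: ws)) else None.
Proof.
move=> uw; elim/last_ind: ws => [|ws b IH]; first by rewrite /= cats0 uw.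
rewrite -rcons_cons flatten_rcons => sb.
have -> : mu_it (rcons (w :: ws) b) = obind (fun a => join a b) (mu_it (w :: ws)).
  by rewrite /= foldl_rcons.
rewrite IH; last by apply: subseq_sorted sb; [exact: leq_trans | exact: prefix_subseq].
case: ifP => [_|nu] /=; last by rewrite cat_uniq nu.
by rewrite /join sorted_sort //; exact: leq_trans.
Qed.

Lemma Dit_uniq n v t : uniq v -> t \in Dit n v -> all uniq t.
Proof.
elim: n v t => [|n IH] v t uv /=; first by rewrite inE => /eqP-> /=; rewrite uv.
case/flattenP=> _ /mapP[p /mapP[i _ ->] ->] /mapP[u Hu ->].
by rewrite all_rcons drop_uniq //= (IH _ _ (take_uniq _ uv) Hu).
Qed.

Lemma sum_surjlike_top m s d (F : seq (seq nat) -> nat) : is_surj m s ->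
  \sum_(T <- surjlike_top m s d) F T = \sum_(T <- phi_top m s d) F T.
Proof.
move=> sm; rewrite phi_top_Dit // /surjlike_top big_pmap.
apply: eq_big_seq => t tD.
have st : size t = size s.
  by rewrite (size_Dit tD) prednK //; case/and3P: sm.
have ut := Dit_uniq (iota_uniq _ _) tD.
have sorted_t := Dit_sorted (iota_sorted _ _) tD.
rewrite (@osequence_map _ _ uniq _ flatten) ?blocks_word //; first by case: ifP.
move=> _ /mapP[r rm ->].
set bl := [seq _ | i <- _ & _].
(* Surjectivity gives every label a piece, so the default [None] of [mu_it] on an empty block is not
   met. *)
have bl0 : bl != [::].
  rewrite /bl -size_eq0 size_map size_filter -lt0n -has_count.
  case/and3P: sm => _ _ /allP/(_ r rm) rs; apply/hasP.
  exists (index r s).+1; last by rewrite /= nth_index.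
  by rewrite mem_iota add1n !ltnS /= index_mem.
have blt : subseq (flatten bl) (flatten t).
  rewrite /bl.
  have -> : flatten t = flatten [seq nth [::] t i.-1 | i <- iota 1 (size s)].
    rewrite -{1}(mkseq_nth [::] t) /mkseq st (iotaDl 1 0) -map_comp.
    by congr flatten; apply: eq_map.
  elim: (iota _ _) => //= i l IH; case: ifP => _ /=; first by rewrite cat_subseq.
  exact: subseq_trans IH (suffix_subseq _ _).
have sbl : sorted leq (flatten bl) by apply: subseq_sorted blt _ => //; exact: leq_trans.
have ubl : all uniq bl.
  apply/allP => w /mapP[i]; rewrite mem_filter mem_iota => /andP[_ ib] ->.
  by apply: (allP ut); apply: mem_nth; rewrite st; lia.
by case: bl bl0 sbl ubl {blt} => // w ws _ sbl /andP[uw _]; rewrite mu_it_flatten.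
Qed.

(** * Composites of surjections as relabelled merged sequences *)

Definition relabel (r m : nat) (l : nat + nat) : nat :=
  match l with
  | inl y => if r < y then y + m.-1 else y
  | inr x => r.-1 + x
  end.

Lemma shuf_notin r s' s : r \notin s' ->
  shuf r s' s = if size s == 1 then [:: map inl s'] else [::].
Proof.
elim: s' => //= y s1 IH; rewrite inE negb_or eq_sym => /andP[/negPf-> /IH->].
by case: ifP.
Qed.

Lemma subst_r_notin r m ch s' : r \notin s' ->
  subst_r r m ch s' = map (relabel r m) (map inl s').
Proof.
by elim: s' => //= y s1 IH; rewrite inE negb_or eq_sym => /andP[/negPf-> /IH->].
Qed.

Lemma sum_Dit_subst r m (s' s : seq nat) (F : seq nat -> nat) : r \in s' -> s != [::] ->
  \sum_(t <- Dit (count_mem r s').-1 s) F (subst_r r m (map (map (addn r.-1)) t) s') =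
  \sum_(z <- shuf r s' s) F (map (relabel r m) z).
Proof.
elim: s' s F => // y s1 IH s F; rewrite inE => rs s0.
have inrE w : map (relabel r m) (map inr w) = map (addn r.-1) w by rewrite -map_comp.
have [yr|yr] := eqVneq y r; last first.
  rewrite /= (negPf yr) big_map; move: rs; rewrite eq_sym (negPf yr) /= => rs.
  by rewrite add0n (IH s (fun z => F (relabel r m (inl y) :: z))).
subst y; rewrite sum_shuf_cons /= eqxx add1n /=.
have [rs1|rs1] := boolP (r \in s1); last first.
  rewrite (count_memPn rs1) big_seq1 /= subst_r_notin //.
  (* The chunk at the last occurrence of [r] takes all that is left of [s]; in [shuf] the base case
     enforces this by admitting only the cut at the final entry. *)
  rewrite -(sum_aw_end (fun w => F (map (addn r.-1) w ++ _)) s0).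
  apply: eq_bigr => p _; rewrite shuf_notin //; case: ifP => _; last by rewrite big_nil.
  by rewrite big_seq1 map_cat inrE.
have : count_mem r s1 != 0 by rewrite -lt0n -has_count has_pred1.
case E : (count_mem r s1) => [|c] // _.
rewrite Dit_left; apply: eq_big_seq => p /aw_nil2 p0.
have := IH p.2 (fun z => F (map (addn r.-1) p.1 ++ z)) rs1 p0.
rewrite E /= => ->; apply: eq_bigr => z _.
by rewrite map_cat inrE.
Qed.

Lemma sum_sur_comp1 r m (s' s : seq nat) (F : seq nat -> nat) : r \in s' -> s != [::] ->
  \sum_(z <- sur_comp1 r m s' s) F z = \sum_(z <- shuf r s' s) F (map (relabel r m) z).
Proof.
move=> rs' s0; rewrite -sum_Dit_subst // /sur_comp1 big_map /jseqs.
have : count_mem r s' != 0 by rewrite -lt0n -has_count has_pred1.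
case: (count_mem r s') => // k _; rewrite big_map.
have sz : 0 < size s by case: s s0.
set N := size s in sz *.
pose g i := nth 0 s i.-1.
have sE : s = map g (interval 1 (size s)).
  rewrite /interval subn1 prednK // (iotaDl 1 0) -map_comp -{1}(mkseq_nth 0 s).
  by rewrite /mkseq; apply: eq_map.
pose pc a b := take (b - a).+1 (drop a.-1 s).
rewrite [in RHS]sE -(sum_wincr_Dit (pc := pc)) //.
  by apply: eq_bigr => l _; rewrite -map_comp.
move=> i j i1 ij js; rewrite /pc /interval.
apply: (@eq_from_nth _ 0).
  rewrite size_takel ?size_map ?size_iota // size_drop -/N; lia.
rewrite size_takel ?size_drop -/N; last by lia.
move=> x ltx; rewrite nth_take // nth_drop (nth_map 0) ?size_iota // nth_iota //.
by rewrite /g; congr nth; lia.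
Qed.

Lemma is_surjP m s : reflect
  [/\ s != [::], {in s, forall v, 0 < v <= m} & forall r, 0 < r <= m -> r \in s]
  (is_surj m s).
Proof.
rewrite /is_surj -size_eq0 -lt0n.
apply: (iffP and3P) => -[s0 /= H1 H2]; split=> //.
- by move=> v vs; apply: (allP H1).
- by move=> r rm; apply: (allP H2); rewrite mem_iota; lia.
- by apply/allP.
- by apply/allP => r; rewrite mem_iota => rm; apply: H2; lia.
Qed.

Lemma is_surj_label m s x : is_surj m s -> x \in s -> x \in iota 1 m.
Proof. by case/is_surjP=> _ /(_ x) + _ xs; rewrite mem_iota => /(_ xs); lia. Qed.

Lemma shuf_inl r s' s z y : z \in shuf r s' s -> (inl y \in z) = (y \in s') && (y != r).
Proof.
elim: s' s z => [|x s1 IH] s z /=.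
  by case: ifP => // _; rewrite inE => /eqP->.
case: eqP => [->|/eqP xr].
  case/flattenP=> _ /mapP[p _ ->] /mapP[z' /IH Hz ->].
  rewrite mem_cat Hz inE.
  have -> : (inl y \in [seq (inr i : nat + nat) | i <- p.1]) = false.
    by apply/negbTE/mapP => -[].
  by case: eqP => //= _; rewrite andbF.
case/mapP=> z' /IH Hz ->; rewrite !inE Hz.
have -> : (inl y == inl x :> nat + nat) = (y == x) by [].
by case: eqP => // ->; rewrite xr.
Qed.

Lemma shuf_inr r s' s z x : z \in shuf r s' s -> inr x \in z -> x \in s.
Proof.
elim: s' s z => [|y s1 IH] s z /=.
  by case: ifP => // _; rewrite inE => /eqP->.
case: eqP => _; last by case/mapP=> z' /IH Hz ->; rewrite inE.
case/flattenP=> _ /mapP[p ps ->] /mapP[z' /IH Hz ->].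
rewrite mem_cat => /orP[/mapP[i ip [->]]|/Hz]; first exact: aw_sub1 ip.
exact: aw_sub2.
Qed.

(** Once no [r] is left, the rest of [s] is the single overlap entry, already emitted with the
    previous chunk; hence [behead] in the induction statement. *)
Lemma shuf_inr_sup r s' s z x : z \in shuf r s' s ->
  x \in (if r \in s' then s else behead s) -> inr x \in z.
Proof.
elim: s' s z => [|y s1 IH] s z /=.
  by case: s => [|a [|b s]].
rewrite inE eq_sym; case: eqP => [_|_] /=; last first.
  by case/mapP=> z' /IH Hz -> /Hz; rewrite inE.
case/flattenP=> _ /mapP[p ps ->] /mapP[z' /IH Hz ->] xs.
move: xs; rewrite (aw_cat ps) !mem_cat => /orP[xp|xp].
  by apply/orP; left; apply/mapP; exists x.
by rewrite Hz ?orbT //; case: ifP => // _; apply: mem_behead.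
Qed.

(** [phi_top] is empty on a list that is not surjective, so surjectivity has to survive
    composition. *)
Lemma is_surj_shuf m' m (r : 'I_m') s' s z : is_surj m' s' -> is_surj m s ->
  z \in shuf r.+1 s' s -> is_surj (m' + m).-1 (map (relabel r.+1 m) z).
Proof.
move=> /is_surjP[s'0 s'm s'r] /is_surjP[s0 sm sr] zs.
have rm' := ltn_ord r.
have rs' : r.+1 \in s' by apply: s'r.
have m0 : 0 < m.
  by case: s s0 sm {zs sr} => // x s _ /(_ x (mem_head _ _)); lia.
have zr x : x \in s -> inr x \in z by move=> xs; apply: (shuf_inr_sup zs); rewrite rs'.
apply/is_surjP; split.
- case: s s0 zr {sm sr zs} => // x s _ /(_ x (mem_head _ _)).
  by case: z.
- move=> _ /mapP[[y|x] lz ->] /=.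
    move: lz; rewrite (shuf_inl _ zs) => /andP[/s'm]; case: ifP; lia.
  have := sm _ (shuf_inr zs lz); lia.
move=> l lb; apply/mapP.
(* Labels up to [r] come unchanged from [s'], the next [m] from [s], the others from labels of [s']
   above [r.+1]. *)
have [le1|gt1] := leqP l r.
  exists (inl l); last by rewrite /= ifF //; lia.
  by rewrite (shuf_inl _ zs) s'r; lia.
have [le2|gt2] := leqP l (r + m).
  exists (inr (l - r)); last by rewrite /=; lia.
  by apply/zr/sr; lia.
exists (inl (l - m.-1)); last by rewrite /= ifT; lia.
by rewrite (shuf_inl _ zs) s'r; lia.
Qed.

(** * Factors of a merged path and the composition formula *)

Lemma cutw_label_sub (A : eqType) (s : seq A) v W :
  W \in cutw s v -> {subset map fst W <= s}.
Proof.
elim: s v W => [|x s IH] v W /=; first by case: eqP => // _; rewrite inE => /eqP->.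
case/cutwP=> p _ [W' /IH W'p ->] y.
rewrite map_cat mem_cat inE => /orP[|/W'p->]; last by rewrite orbT.
by rewrite -map_comp => /mapP[i _ ->]; rewrite eqxx.
Qed.

Lemma fac_outl (f : nat + nat -> nat) L y U :
  {in map fst U, forall l, (f l == L) = (l == inl y)} ->
  fac L [seq (f p.1, p.2) | p <- U] = fac y (outl U).
Proof.
elim: U => // -[l b] U IH H.
have {}IH : fac L [seq (f p.1, p.2) | p <- U] = fac y (outl U).
  by apply: IH => l' lU; apply: H; rewrite inE lU orbT.
rewrite /fac /= (H l (mem_head _ _)); case: l H => [i|i] _ /=; last exact: IH.
have -> : (inl i == inl y :> nat + nat) = (i == y) by [].
by case: eqP => _ /=; rewrite -/(fac _ _) IH.
Qed.

Lemma fac_outr (f : nat + nat -> nat) L y U :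
  {in map fst U, forall l, (f l == L) = (l == inr y)} ->
  fac L [seq (f p.1, p.2) | p <- U] = fac y (outr U).
Proof.
elim: U => // -[l b] U IH H.
have {}IH : fac L [seq (f p.1, p.2) | p <- U] = fac y (outr U).
  by apply: IH => l' lU; apply: H; rewrite inE lU orbT.
rewrite /fac /= (H l (mem_head _ _)); case: l H => [i|i] _ /=; first exact: IH.
have -> : (inr i == inr y :> nat + nat) = (i == y) by [].
by case: eqP => _ /=; rewrite -/(fac _ _) IH.
Qed.

Lemma take_factors r m W : r <= m -> take r (factors m W) = [seq fac l W | l <- iota 1 r].
Proof. by move=> rm; rewrite /factors -map_take take_iota (minn_idPl rm). Qed.

Lemma drop_factors r m W :
  drop r (factors m W) = [seq fac l W | l <- iota r.+1 (m - r)].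
Proof. by rewrite /factors -map_drop drop_iota. Qed.

Lemma factors_relabel m' m (r : 'I_m') s' s z v U :
  is_surj m' s' -> is_surj m s -> z \in shuf r.+1 s' s -> U \in cutw z v ->
  factors (m' + m).-1 [seq (relabel r.+1 m p.1, p.2) | p <- U] =
  take r (factors m' (outl U)) ++ factors m (outr U) ++
  drop r.+1 (factors m' (outl U)).
Proof.
move=> /is_surjP[s'0 s'm s'r] /is_surjP[s0 sm sr] zs Uz.
have rm' := ltn_ord r.
have m0 : 0 < m.
  by case: s s0 sm {zs sr} => // x s _ /(_ x (mem_head _ _)); lia.
have Hl y : inl y \in map fst U -> (0 < y <= m') && (y != r.+1).
  by move/(cutw_label_sub Uz); rewrite (shuf_inl _ zs) => /andP[/s'm -> ->].
have Hr x : inr x \in map fst U -> 0 < x <= m.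
  by move/(cutw_label_sub Uz)/(shuf_inr zs)/sm.
have inlE (i j : nat) : (inl i == inl j :> nat + nat) = (i == j) by [].
have inrE (i j : nat) : (inr i == inr j :> nat + nat) = (i == j) by [].
rewrite take_factors ?drop_factors; last exact: ltnW.
have -> : (m' + m).-1 = r + (m + (m' - r.+1)) by lia.
rewrite {1}/factors !iotaD !map_cat; congr (_ ++ (_ ++ _)).
- apply/eq_in_map => l; rewrite mem_iota => lb; apply: fac_outl => -[y /Hl|x /Hr] /=.
    by rewrite inlE; case: ifP; lia.
  by have -> : (inr x == inl l :> nat + nat) = false by []; lia.
- rewrite addnC iotaDl -map_comp; apply/eq_in_map => l; rewrite mem_iota => lb.
  apply: fac_outr => -[y /Hl|x /Hr] /=.
    by have -> : (inl y == inr l :> nat + nat) = false by []; case: ifP; lia.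
  by rewrite inrE; lia.
have -> : 1 + r + m = m.-1 + r.+2 by lia.
rewrite iotaDl -map_comp; apply/eq_in_map => l; rewrite mem_iota => lb.
apply: fac_outl => -[y /Hl|x /Hr] /=.
  by rewrite inlE; case: ifP; lia.
by have -> : (inr x == inl l :> nat + nat) = false by []; lia.
Qed.

Lemma fac_unm r l W : l != r -> fac l (unm r W) = fac l W.
Proof.
move=> lr; rewrite /fac /unm -filter_predI; congr map; apply: eq_filter => p /=.
by case: eqP => // ->.
Qed.

Lemma all_uniq_cat (T1 T2 T3 : seq (seq nat)) :
  all uniq (T1 ++ T2 ++ T3) = [&& all uniq T1, all uniq T2 & all uniq T3].
Proof. by rewrite !all_cat. Qed.

(** Compatibility of the interval-cut action with partial composition. On the left [s] acts on a
    simplex numbered from 0, and [nth 0 (nth [::] T r)] carries the result back to the vertices of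
    the r-th factor. *)
Lemma phi_top_comp m' m (r : 'I_m') s' s d (H : seq (seq nat) -> nat) :
  is_surj m' s' -> is_surj m s ->
  \sum_(T <- phi_top m' s' d) \sum_(b <- phi_top m s (size (nth [::] T r)).-1)
     H (take r T ++ map (map (nth 0 (nth [::] T r))) b ++ drop r.+1 T) =
  \sum_(z <- sur_comp1 r.+1 m s' s) \sum_(U <- phi_top (m' + m).-1 z d) H U.
Proof.
move=> s's ss.
have [s'0 s'm s'r] := is_surjP _ _ s's; have [s0 sm sr] := is_surjP _ _ ss.
have rm' := ltn_ord r.
have rs' : r.+1 \in s' by apply: s'r.
pose K A W :=
  let T := take r (factors m' A) ++ factors m W ++ drop r.+1 (factors m' A) in
  if all uniq T then H T else 0.
transitivity (\sum_(W' <- cutw s' (iota 0 d.+1))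
    \sum_(W <- cutw s (fac r.+1 W')) K (unm r.+1 W') W); last first.
  rewrite cutw_shuf // sum_sur_comp1 //; apply: eq_big_seq => z zs.
  rewrite (perm_big _ (phi_top_cutw _ (is_surj_shuf s's ss zs))) big_filter big_map.
  rewrite [RHS]big_mkcond sum_cutw_label; apply: eq_big_seq => U Uz.
  by rewrite /K -(factors_relabel s's ss zs Uz).
rewrite (perm_big _ (phi_top_cutw _ s's)) big_filter big_map big_mkcond.
apply: eq_big_seq => W' W's.
set w := fac r.+1 W'.
have w0 : w != [::] by apply: cutw_fac_nil W's rs'.
have -> : nth [::] (factors m' W') r = w.
  by rewrite (nth_map 0) ?size_iota // nth_iota.
have sw : sorted leq w.
  have /(subseq_sorted leq_trans) := fac_subseq r.+1 W'.
  by apply; apply: cutw_sorted W's; apply: iota_sorted.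
have takeE : take r (factors m' (unm r.+1 W')) = take r (factors m' W').
  rewrite !take_factors; try exact: ltnW.
  by apply/eq_in_map => l; rewrite mem_iota => lb; rewrite fac_unm //; lia.
have dropE : drop r.+1 (factors m' (unm r.+1 W')) = drop r.+1 (factors m' W').
  rewrite !drop_factors.
  by apply/eq_in_map => l; rewrite mem_iota => lb; rewrite fac_unm //; lia.
have factE : factors m' W' =
    take r (factors m' W') ++ [:: w] ++ drop r.+1 (factors m' W').
  rewrite take_factors ?drop_factors; last exact: ltnW.
  have {1}-> : m' = r + (1 + (m' - r.+1)) by lia.
  by rewrite /factors !iotaD !map_cat add1n addn1.
have uE : all uniq (factors m' W') =
    [&& all uniq (take r (factors m' W')), uniq w & all uniq (drop r.+1 (factors m' W'))].
  by rewrite {1}factE all_uniq_cat /= andbT.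
(* A repetition in [w] discards the outer summand on the left; on the right it reappears in an inner
   factor by [cutw_uniq], so [K] is zero. *)
rewrite uE; have [uw|nuw] := boolP (uniq w); last first.
  rewrite andbF /= big1_seq // => W /andP[_ Ws]; rewrite /K.
  rewrite all_uniq_cat; case: ifP => // /and3P[_ uf _]; case/negP: nuw.
  apply: cutw_uniq sw Ws _ => x xs; apply: (allP uf).
  exact/map_f/(is_surj_label ss).
have wE : w = map (nth 0 w) (iota 0 (size w)) by rewrite -{1}(mkseq_nth 0 w).
rewrite [in RHS]wE sum_cutw_map (perm_big _ (phi_top_cutw _ ss)) big_filter big_map.
rewrite prednK ?lt0n ?size_eq0 // big_mkcond /=.
case: ifP => uT; last first.
  rewrite big1_seq // => W _; rewrite /K takeE dropE all_uniq_cat.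
  by case: ifP => // /and3P[u1 _ u3]; rewrite u1 u3 in uT.
apply: eq_big_seq => W Ws.
have fE : factors m [seq (p.1, nth 0 w p.2) | p <- W] =
    map (map (nth 0 w)) (factors m W).
  rewrite /factors -map_comp; apply: eq_map => l /=.
  by rewrite /fac filter_map -!map_comp.
rewrite /K takeE dropE fE all_uniq_cat.
case/andP: uT => -> ->; rewrite andbT /=.
(* As [w] has distinct entries, [nth 0 w] is injective on positions, so renumbering neither creates
   nor hides repetitions. *)
have -> // : all uniq (map (map (nth 0 w)) (factors m W)) = all uniq (factors m W).
rewrite all_map; apply: eq_in_all => _ /mapP[l _ ->] /=.
rewrite map_inj_in_uniq // => i j /(mem_subseq (fac_subseq l W))/(cutw_sub Ws).
rewrite mem_iota => ib /(mem_subseq (fac_subseq l W))/(cutw_sub Ws).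
by rewrite mem_iota => jb /eqP; rewrite nth_uniq // => /eqP.
Qed.

(** * Faces and degeneracies in a simplicial set *)

(** By monotonicity [h] agrees at [i] and [i.+1], hence factors through the codegeneracy that merges
    them. *)
Lemma sact_degenerate (X : sSet) q k (h : 'I_q.+1 -> 'I_k.+1) (z : X k) (i j : 'I_q.+1) :
  monotone h -> i < j -> h i = h j ->
  degenerate (existT (fun n => X n) q (sact h z)).
Proof.
case: q h i j => [|q] h i j hm ij hij.
  by move: (ltn_ord j) ij; rewrite ltnS leqn0 => /eqP->.
have iq : i < q.+1 by rewrite -ltnS (leq_ltn_trans ij).
(* [si] merges [i] and [i.+1], and [de] is its section skipping [i.+1]; [de \o si] moves only
   [i.+1], to [i]. *)
pose si (x : 'I_q.+2) : 'I_q.+1 := inord (if x <= i then x : nat else x.-1).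
pose de (x : 'I_q.+1) : 'I_q.+2 := inord (if x <= i then x : nat else x.+1).
have siE x : si x = (if x <= i then x : nat else x.-1) :> nat.
  by rewrite inordK //; case: ifP; have := ltn_ord x; lia.
have deE x : de x = (if x <= i then x : nat else x.+1) :> nat.
  by rewrite inordK //; case: ifP; have := ltn_ord x; lia.
have sim : monotone si by move=> x y xy; rewrite !siE; do 2!case: ifP; lia.
have dem : monotone de by move=> x y xy; rewrite !deE; do 2!case: ifP; lia.
have hdm : monotone (h \o de) by move=> x y xy; apply/hm/dem.
exists q, si, (sact (h \o de) z); split=> //; split=> //=.
rewrite sact_comp //; apply: sact_ext => x /=.
have dsE : de (si x) = (if x == i.+1 :> nat then i : nat else x) :> nat.
  by rewrite deE siE; case: (leqP x i) => xi; do 2?case: ifP; lia.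
move: dsE; case: eqP => [xi dsE|_ dsE]; last by congr h; apply: val_inj.
have -> : de (si x) = i by apply: val_inj.
apply: val_inj; apply/eqP; rewrite eqn_leq; apply/andP; split.
  by rewrite hij; apply: hm; rewrite xi.
by apply: hm; rewrite xi.
Qed.

Lemma ltn_ord_eq n m (i : 'I_n) : n = m -> i < m.
Proof. by move=> <-. Qed.

(** [sact] is functorial on monotone maps, whence the sortedness; bounds and nonemptiness keep
    [inord] and [nth] off their default values. *)
Lemma face_face (X : sSet) d (x : X d) v w :
  sorted leq v -> {in v, forall i, i <= d} -> v != [::] ->
  sorted leq w -> {in w, forall i, i < size v} -> w != [::] ->
  face (sact (fun i : 'I_(size v).-1.+1 => inord (nth 0 v i) : 'I_d.+1) x) w =
  face x (map (nth 0 v) w).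
Proof.
move=> sv vd v0 sw wv w0.
have szv : (size v).-1.+1 = size v by rewrite prednK // lt0n size_eq0.
have szw : (size w).-1.+1 = size w by rewrite prednK // lt0n size_eq0.
rewrite /face size_map; congr (existT _ _ _).
have wi (i : 'I_(size w).-1.+1) : nth 0 w i < size v.
  exact/wv/mem_nth/ltn_ord_eq.
rewrite sact_comp.
- apply: sact_ext => i /=; rewrite inordK ?szv //.
  by rewrite (nth_map 0) //; apply: ltn_ord_eq.
- move=> i j ij; rewrite !inordK ?ltnS; try exact/vd/mem_nth/ltn_ord_eq.
  by apply: (sorted_leq_nth leq_trans leqnn) => //; apply: ltn_ord_eq.
move=> i j ij; rewrite !inordK ?szv //.
by apply: (sorted_leq_nth leq_trans leqnn) => //; apply: ltn_ord_eq.
Qed.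

Lemma phi_top_mem m s d T : is_surj m s -> T \in phi_top m s d ->
  exists2 W, W \in cutw s (iota 0 d.+1) & T = factors m W /\ all uniq T.
Proof.
move=> sm; rewrite (perm_mem (phi_top_cutw d sm)) mem_filter.
by case/andP=> uT /mapP[W Ws E]; exists W.
Qed.

Lemma phi_top_face m s d T v : is_surj m s -> T \in phi_top m s d -> v \in T ->
  [/\ sorted leq v, {in v, forall i, i <= d} & v != [::]].
Proof.
move=> sm /(phi_top_mem sm)[W Ws [-> _]] /mapP[r rm ->]; split.
- apply: (subseq_sorted leq_trans (fac_subseq r W)).
  by apply: cutw_sorted Ws; apply: iota_sorted.
- move=> i /(mem_subseq (fac_subseq r W))/(cutw_sub Ws).
  by rewrite mem_iota.
apply: cutw_fac_nil Ws _; case/is_surjP: sm => _ _; apply.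
by move: rm; rewrite mem_iota; lia.
Qed.

(** Otherwise [f] is strictly increasing, so [f i] is at least [i] throughout and the last value
    exceeds [k]. *)
Lemma monotone_adjacent d k (f : 'I_d.+1 -> 'I_k.+1) : monotone f -> k < d ->
  exists2 a, a < d & f (inord a) = f (inord a.+1).
Proof.
move=> fm kd; case: (boolP [exists a : 'I_d, f (inord a) == f (inord a.+1)]).
  by case/existsP=> a /eqP E; exists a.
move/existsPn=> H.
have lef i : i <= d -> i <= f (inord i).
  elim: i => // i IH id; have id' : i < d.+1 by lia.
  apply: (leq_ltn_trans (IH (ltnW id))).
  rewrite ltn_neqAle (inj_eq val_inj) (H (Ordinal id)).
  by apply: fm; rewrite !inordK.
have := lef d (leqnn _); have := ltn_ord (f (inord d)); lia.
Qed.

(* Some factor of each summand contains two consecutive vertices that a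
   degenerate simplex identifies. *)
Lemma phi_top_degenerate (X : sSet) m s d (y : X d) T : is_surj m s ->
  degenerate (existT (fun n => X n) d y) -> T \in phi_top m s d ->
  has (fun c => `[< degenerate c >]) (map (face y) T).
Proof.
move=> sm [k [f [z [kd [fm /= ->]]]]] TP.
have [W Ws [TE uT]] := phi_top_mem sm TP.
have [a ad fa] := monotone_adjacent fm kd.
have E : iota 0 d.+1 = iota 0 a ++ [:: a, a.+1 & iota a.+2 (d - a.+1)].
  have -> : d.+1 = a + (d - a.+1).+2 by rewrite !addnS -addSn subnKC.
  by rewrite iotaD.
have := Ws; rewrite E => /cutw_adjacent[x xs /andP[xa xb]].
rewrite has_map; apply/hasP.
have xT : fac x W \in T.
  rewrite TE; apply/mapP; exists x => //.
  by case/is_surjP: sm => _ /(_ x xs); rewrite mem_iota; lia.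
exists (fac x W) => //=; apply/asboolP.
have [sv vd v0] := phi_top_face sm TP xT.
set v := fac x W in xa xb xT sv vd v0 *.
have uv : uniq v by apply: (allP uT).
have szv : (size v).-1.+1 = size v by rewrite prednK // lt0n size_eq0.
pose g (i : 'I_(size v).-1.+1) : 'I_d.+1 := inord (nth 0 v i).
have gm : monotone g.
  move=> i j ij; rewrite !inordK ?ltnS; try exact/vd/mem_nth/ltn_ord_eq.
  by apply: (sorted_leq_nth leq_trans leqnn) => //; apply: ltn_ord_eq.
rewrite /face -/g sact_comp //.
have ia : index a v < (size v).-1.+1 by rewrite szv index_mem.
have ib : index a.+1 v < (size v).-1.+1 by rewrite szv index_mem.
apply: (@sact_degenerate X _ _ _ _ (Ordinal ia) (Ordinal ib)).
- by move=> i j ij; apply/fm/gm.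
- rewrite /= ltnNge; apply/negP => ba.
  have : nth 0 v (index a.+1 v) <= nth 0 v (index a v).
    by apply: (sorted_leq_nth leq_trans leqnn); rewrite ?inE ?index_mem.
  by rewrite !nth_index // ltnn.
by rewrite /= /g /= !nth_index.
Qed.

(** * Action of the symmetric group *)

Lemma tperm_tuple_nth (T : Type) m (sg : 'S_m) (c0 : T) b : size b = m ->
  tperm_tuple sg b = [seq nth c0 b ((sg^-1)%g j) | j <- enum 'I_m].
Proof.
move=> sb; rewrite /tperm_tuple; elim: (enum _) => //= j l <-.
have := onthTE b ((sg^-1)%g j); rewrite sb ltn_ord.
by case E: (onth b _) => [c|] // _; rewrite (onth_nth c0 _ _ _ E).
Qed.

Lemma tperm_tuple_nil (T : Type) m (sg : 'S_m) : tperm_tuple sg [::] = [::] :> seq T.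
Proof. by rewrite /tperm_tuple; elim: (enum _) => //= j l ->; rewrite onth0n. Qed.

Lemma size_tperm_tuple (T : Type) m (sg : 'S_m) (b : seq T) :
  size b = m -> size (tperm_tuple sg b) = m.
Proof.
case: b => [|c0 b] sb; first by rewrite tperm_tuple_nil.
by rewrite (tperm_tuple_nth sg c0 sb) size_map size_enum_ord.
Qed.

Lemma tperm_tuple_map (A B : Type) (f : A -> B) m (sg : 'S_m) b :
  tperm_tuple sg (map f b) = map f (tperm_tuple sg b).
Proof.
rewrite /tperm_tuple; elim: (enum _) => //= j l ->.
by rewrite onth_map; case: (onth b _).
Qed.

Lemma all_tperm_tuple (T : Type) m (sg : 'S_m) (P : pred T) b : size b = m ->
  all P (tperm_tuple sg b) = all P b.
Proof.
case: b => [|c0 b]; first by rewrite tperm_tuple_nil.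
move=> sb; rewrite (tperm_tuple_nth sg c0 sb) all_map.
apply/allP/(all_nthP c0) => [H i|H j _ /=]; last by apply: H; rewrite sb.
rewrite sb => im; have := H (sg (Ordinal im)) (mem_enum _ _).
by rewrite /= permK.
Qed.

Lemma has_tperm_tuple (T : Type) m (sg : 'S_m) (P : pred T) b : size b = m ->
  has P (tperm_tuple sg b) = has P b.
Proof.
by move=> sb; rewrite -[LHS]negbK -all_predC all_tperm_tuple // all_predC negbK.
Qed.

Lemma sur_act_label m (sg : 'S_m) s i (j : 'I_m) : is_surj m s -> i < size s ->
  (nth 0 (sur_act sg s) i == j.+1) = (nth 0 s i == ((sg^-1)%g j).+1).
Proof.
case/is_surjP=> _ sm _ si; rewrite (nth_map 0) //.
have := sm _ (mem_nth 0 si); case: (nth 0 s i) => // v /= vm.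
rewrite insubT /= !eqSS; set o : 'I_m := Sub v vm.
have -> : (v == (sg^-1)%g j) = (o == (sg^-1)%g j) by [].
by rewrite (inj_eq val_inj); apply/eqP/eqP => [<-|->]; rewrite ?permK ?permKV.
Qed.

Lemma is_surj_act m (sg : 'S_m) s : is_surj m s -> is_surj m (sur_act sg s).
Proof.
move=> sS; have [s0 sm sr] := is_surjP _ _ sS; apply/is_surjP; split.
- by case: s s0 {sm sr sS}.
- move=> _ /mapP[v vs ->]; have := sm v vs; case: v {vs} => // v /= vm.
  by rewrite insubT /=.
case=> // j jm; have := sr ((sg^-1)%g (Ordinal jm)).+1.
rewrite ltn_ord => /(_ isT) js; apply/(nthP 0).
exists (index ((sg^-1)%g (Ordinal jm)).+1 s); first by rewrite size_map index_mem.
apply/eqP; rewrite (@sur_act_label m sg s _ (Ordinal jm)) ?index_mem //.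
by rewrite nth_index.
Qed.

(** Renaming labels leaves the cuts alone, so summands correspond one by one in the same order, with
    their factors permuted. *)
Lemma phi_top_act m (sg : 'S_m) s d : is_surj m s ->
  phi_top m (sur_act sg s) d = map (tperm_tuple sg) (phi_top m s d).
Proof.
move=> sm; rewrite /phi_top sm is_surj_act //= size_map.
set A := (fun l => map _ (iota 1 m)); set B := (fun l => map _ (iota 1 m)).
have AE l : A l = tperm_tuple sg (B l).
  rewrite (tperm_tuple_nth _ [::]); last by rewrite size_map size_iota.
  rewrite /A.
  have -> : iota 1 m = [seq (val j).+1 | j <- enum 'I_m].
    by rewrite (map_comp S) val_enum_ord (iotaDl 1 0).
  rewrite -map_comp; apply: eq_map => j /=.
  rewrite (nth_map 0) ?size_iota // nth_iota // add1n.
  congr flatten; congr map; apply: eq_in_filter => i; rewrite mem_iota => ib.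
  by rewrite sur_act_label //; lia.
rewrite (eq_map AE) map_comp filter_map; congr map.
rewrite filter_map; elim: (wincr _ _ _) => //= l ls IH.
by rewrite all_tperm_tuple ?size_map ?size_iota //; case: ifP => _ /=; rewrite IH.
Qed.

(** * Induction over operad expressions *)

Lemma all_evalSur m (t : sterm m) : all (is_surj m) (evalSur t).
Proof.
elim: t => {m} [m s sm|m' m r t IHt u IHu|m sg t IH|m t IHt u IHu|m] /=.
- by rewrite sm.
- apply/allP => z /flatten_mapP[a at_ /flatten_mapP[b bu zab]].
  have sa := allP IHt a at_; have sb := allP IHu b bu.
  have [b0 _ _] := is_surjP _ _ sb; have [_ _ /(_ r.+1 (ltn_ord r)) ra] := is_surjP _ _ sa.
  have /perm_mem E : perm_eq (sur_comp1 r.+1 m a b)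
      [seq map (relabel r.+1 m) z | z <- shuf r.+1 a b].
    by apply: sum_eq_perm => F; rewrite sum_sur_comp1 // big_map.
  by move: zab; rewrite E => /mapP[z' zs ->]; apply: is_surj_shuf zs.
- by rewrite all_map; apply: sub_all IH => s /= /is_surj_act.
- by rewrite all_cat IHt.
by [].
Qed.

Lemma all_flatten_map (A B : Type) (P : pred B) (f : A -> seq B) l :
  all P (flatten [seq f x | x <- l]) = all (fun x => all P (f x)) l.
Proof. by elim: l => //= x l IH; rewrite all_cat IH. Qed.

Lemma size_osequence (A : Type) (l : seq (option A)) l' :
  osequence l = Some l' -> size l' = size l.
Proof.
elim: l l' => [|[a|] l IH] l' //=; first by case=> <-.
by case: (osequence l) IH => //= l2 /(_ _ erefl) <- [<-].
Qed.

Lemma size_evalEnd (X : sSet) m (t : sterm m) c :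
  all (fun b => size b == m) (evalEnd X t c).
Proof.
elim: t c => {m} [m s sm|m' m r t IHt u IHu|m sg t IH|m t IHt u IHu|m] c //=.
- case: c => d y; rewrite /kan all_map all_pmap.
  apply/allP => t _ /=; case E: (osequence _) => [T|] //=.
  by rewrite size_map (size_osequence E) !size_map size_iota.
- rewrite /end_comp all_flatten_map; apply: sub_all (IHt c) => b /eqP sb.
  have := onthTE b r; rewrite sb ltn_ord; case: (onth b r) => [cr|] //= _.
  case: asboolP => //= _; rewrite all_map; apply: sub_all (IHu cr) => b' /eqP sb' /=.
  have rm := ltn_ord r.
  rewrite !size_cat size_drop sb' size_takel sb; last exact: ltnW.
  by apply/eqP; lia.
- rewrite /end_act all_map; apply: sub_all (IH c) => b /= /eqP sb.
  by rewrite size_tperm_tuple.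
by rewrite all_cat IHt IHu.
Qed.

Lemma size_phi_top m s d T : T \in phi_top m s d -> size T = m.
Proof.
rewrite /phi_top; case: ifP => // _; rewrite mem_filter => /andP[_ /mapP[l _ ->]].
by rewrite size_map size_iota.
Qed.

Lemma eq_big_all (A : Type) (P : pred A) (l : seq A) (F G : A -> nat) :
  all P l -> (forall x, P x -> F x = G x) -> \sum_(x <- l) F x = \sum_(x <- l) G x.
Proof.
move=> Pl FG; elim: l Pl => [|x l IH] /=; first by rewrite !big_nil.
by case/andP=> /FG Fx /IH E; rewrite !big_cons Fx E.
Qed.

Lemma sum_phiX (X : sSet) m x d (y : X d) (F : seq (cell X) -> nat) :
  \sum_(b <- phiX X m x (existT _ d y)) F b =
  \sum_(s <- x) \sum_(T <- phi_top m s d) F (map (face y) T).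
Proof. by rewrite sum_flatten_map; apply: eq_bigr => s _; rewrite big_map. Qed.

(* The function [F] is an arbitrary test function on elementary tensors that
   vanishes on the degenerate ones, so this is an equality of multisets of
   nondegenerate elementary tensors: no cancellation mod 2 is needed. *)
Lemma sum_evalEnd (X : sSet) m (t : sterm m) c (F : seq (cell X) -> nat) :
  (forall b, has (fun c => `[< degenerate c >]) b -> F b = 0) ->
  \sum_(b <- evalEnd X t c) F b = \sum_(b <- phiX X m (evalSur t) c) F b.
Proof.
elim: t c F => {m} [m s sm|m' m r t IHt u IHu|m sg t IH|m t IHt u IHu|m] c F HF.
- by case: c => d y; rewrite sum_phiX big_seq1 /= big_map sum_surjlike_top.
- rewrite [evalEnd _ _]/= /end_comp sum_flatten_map.
  (* The contribution of one outer tensor [b] when [g] is inserted at place [r]; it becomes the test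
     function for the outer expression. *)
  pose G g b := match onth b r with
    | Some cr => if `[< degenerate cr >] then 0
                 else \sum_(b' <- g cr) F (take r b ++ b' ++ drop r.+1 b)
    | None => 0 end.
  transitivity (\sum_(b <- evalEnd X t c) G (evalEnd X u) b).
    apply: eq_bigr => b _; rewrite /G; case: (onth b r) => [cr|]; last by rewrite big_nil.
    by case: ifP => _; rewrite ?big_nil ?big_map.
  transitivity (\sum_(b <- evalEnd X t c) G (phiX X m (evalSur u)) b).
    apply: eq_bigr => b _; rewrite /G; case: (onth b r) => [cr|] //.
    case: ifP => // _; apply: IHu => b' Hb'; apply: HF.
    by rewrite !has_cat Hb' orbT.
  (* [G] vanishes on degenerate tensors: a degenerate factor at place [r] is stopped by its own
     clause, and any other one stays in every summand. *)
  rewrite IHt; last first.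
    move=> b; rewrite /G; case E: (onth b r) => [cr|] //; case: asboolP => // ncr.
    have bE : b = take r b ++ cr :: drop r.+1 b.
      have rb : r < size b by rewrite -onthTE E.
      by rewrite -{1}(cat_take_drop r b) (drop_nth cr rb) (onth_nth cr _ _ _ E).
    rewrite {1}bE has_cat /= (asboolF ncr) /= => Hb.
    rewrite big1 // => b' _; apply: HF; rewrite !has_cat.
    by case/orP: Hb => ->; rewrite ?orbT.
  case: c => d y; rewrite !sum_phiX [evalSur _]/= /sur_comp sum_flatten_map.
  apply: eq_big_seq => a at_; have sa := allP (all_evalSur t) a at_.
  rewrite sum_flatten_map.
  transitivity (\sum_(T <- phi_top m' a d) \sum_(e <- evalSur u)
      \sum_(b <- phi_top m e (size (nth [::] T r)).-1)
      F (map (face y) (take r T ++ map (map (nth 0 (nth [::] T r))) b ++ drop r.+1 T))).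
    apply: eq_big_seq => T TP.
    have sT := size_phi_top TP.
    have vT : nth [::] T r \in T by rewrite mem_nth // sT.
    have [sv vd v0] := phi_top_face sa TP vT.
    set v := nth [::] T r in vT sv vd v0 *.
    have szv : (size v).-1.+1 = size v by rewrite prednK // lt0n size_eq0.
    rewrite /G onth_map; have := onthTE T r; rewrite sT ltn_ord.
    case E : (onth T r) => [v'|] // _; rewrite /= -(onth_nth [::] _ _ _ E) -/v.
    rewrite {2}/face -[face y v]/(existT _ _ _) sum_phiX.
    have faceE e b : is_surj m e -> b \in phi_top m e (size v).-1 ->
        map (face y) (map (map (nth 0 v)) b) =
        map (face (projT2 (face y v))) b.
      move=> se bP; rewrite -map_comp; apply/eq_in_map => w wb /=.
      have [sw wd w0] := phi_top_face se bP wb.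
      by rewrite face_face // => i /wd; rewrite -ltnS szv.
    transitivity (\sum_(e <- evalSur u) \sum_(b <- phi_top m e (size v).-1)
        if `[< degenerate (face y v) >] then 0 else
        F (map (face y) (take r T ++ map (map (nth 0 v)) b ++ drop r.+1 T))).
      case: ifP => _; first by rewrite !big1 // => e _; rewrite big1.
      apply: eq_big_seq => e eu; have se := allP (all_evalSur u) e eu.
      apply: eq_big_seq => b bP.
      by rewrite !map_cat (faceE e b se bP) map_take map_drop.
    apply: eq_big_seq => e eu; have se := allP (all_evalSur u) e eu.
    (* For a degenerate r-th factor the left side is zero by convention, and the right side because
       the inner summand has a degenerate factor. *)
    apply: eq_big_seq => b bP; case: asboolP => // dv.
    apply/esym/HF; rewrite !map_cat !has_cat (faceE e b se bP).
    by rewrite (phi_top_degenerate se dv bP) orbT.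
  rewrite exchange_big; apply: eq_big_seq => e eu; have se := allP (all_evalSur u) e eu.
  exact: (phi_top_comp r d (fun T => F (map (face y) T)) sa se).
(* A degenerate factor is guaranteed to survive the permutation only at length [m], so the test
   function is set to 0 at other lengths. *)
- have sum_act l : all (fun b => size b == m) l ->
      \sum_(b <- [seq tperm_tuple sg b | b <- l]) F b =
      \sum_(b <- l) if size b == m then F (tperm_tuple sg b) else 0.
    by move=> sl; rewrite big_map; apply: (eq_big_all sl) => b /= ->.
  rewrite [evalEnd _ _]/= /end_act sum_act ?size_evalEnd // IH; last first.
    move=> b Hb; case: eqP => // sb; apply: HF.
    by rewrite has_tperm_tuple.
  case: c => d y; rewrite !sum_phiX [evalSur _]/= big_map.
  apply: eq_big_seq => s st; have sm := allP (all_evalSur t) s st.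
  rewrite phi_top_act // big_map; apply: eq_big_seq => T /size_phi_top sT.
  by rewrite size_map sT eqxx tperm_tuple_map.
- by rewrite /= big_cat IHt // IHu // /phiX map_cat flatten_cat big_cat.
by rewrite /phiX !big_nil.
Qed.

Theorem theoremA11 (X : sSet) (m : nat) (x : sterm m) :
  opeq (evalEnd X x) (phiX X m (evalSur x)).
Proof.
move=> c _ b nb; rewrite /tcoef; congr odd.
(* The indicator of [b] is an admissible test function because [b] has no degenerate factor; the
   counts agree even before parity is taken. *)
have H := @sum_evalEnd X m x c (fun a => `[< a = b >] : nat).
rewrite -!sumn_count !sumnE !big_map H // => b' Hb'.
case: asboolP => // E; move: nb Hb'; rewrite {}E {H}.
elim: b => //= a b IH nb; rewrite asboolF => [|/nb]; last by case; left.
by apply: IH => c' c'b; apply: nb; right.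
Qed.
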